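(* Let $M\ge 2$ and $n\ge 1$. Observe $\mathbf{y}=\mathbf{f}+\boldsymbol{\xi}\in\mathbf{R}^n$, where $\mathbf{f}\in\mathbf{R}^n$ is unknown and $\xi_1,\dots,\xi_n$ are i.i.d. $\mathcal N(0,\sigma^2)$. For $j=1,\dots,M$ let $\hat{\boldsymbol\mu}_j=A_j\mathbf{y}+\mathbf{b}_j$, where $A_j$ is a deterministic $n\times n$ real matrix with $\|A_j\|_{op}\le 1$ and $\mathbf{b}_j\in\mathbf{R}^n$ is deterministic. Let $\hat{\boldsymbol\theta}_{\mathrm{pen}}\in\arg\min_{\boldsymbol\theta\in\Lambda^M}H_{\mathrm{pen}}(\boldsymbol\theta)$. Then for all $x>0$, with probability at least $1-2e^{-x}$, \[\|\hat{\boldsymbol\mu}_{\hat{\boldsymbol\theta}_{\mathrm{pen}}}-\mathbf f\|_2^2\le \min_{j=1,\dots,M}\|\hat{\boldsymbol\mu}_j-\mathbf f\|_2^2+46\sigma^2(2\log M+x).\] Furthermore, \[\mathbb E\|\hat{\boldsymbol\mu}_{\hat{\boldsymbol\theta}_{\mathrm{pen}}}-\mathbf f\|_2^2\le \mathbb E\Big[\min_{j=1,\dots,M}\|\hat{\boldsymbol\mu}_j-\mathbf f\|_2^2\Big]+92\sigma^2\log(eM).\]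
   Context: $\|\cdot\|_2$ is the Euclidean norm, $\|\cdot\|_{op}$ the operator norm, $\log$ the natural logarithm. $\Lambda^M=\{\boldsymbol\theta\in\mathbf R^M:\sum_j\theta_j=1,\ \theta_j\ge0\}$. For $\boldsymbol\theta\in\Lambda^M$: $A_{\boldsymbol\theta}=\sum_j\theta_jA_j$, $\mathbf b_{\boldsymbol\theta}=\sum_j\theta_j\mathbf b_j$, $\hat{\boldsymbol\mu}_{\boldsymbol\theta}=A_{\boldsymbol\theta}\mathbf y+\mathbf b_{\boldsymbol\theta}$. Mallows' criterion $C_p(\boldsymbol\theta)=\|\hat{\boldsymbol\mu}_{\boldsymbol\theta}\|_2^2-2\mathbf y^T\hat{\boldsymbol\mu}_{\boldsymbol\theta}+2\sigma^2\mathrm{Tr}(A_{\boldsymbol\theta})$, penalty $\mathrm{pen}(\boldsymbol\theta)=\sum_{j=1}^M\theta_j\|\hat{\boldsymbol\mu}_{\boldsymbol\theta}-\hat{\boldsymbol\mu}_j\|_2^2$, and $H_{\mathrm{pen}}(\boldsymbol\theta)=C_p(\boldsymbol\theta)+\tfrac12\mathrm{pen}(\boldsymbol\theta)$. *)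

(* Defs.v *)
From HB Require Import structures.
From mathcomp Require Import all_boot all_order all_algebra.
From mathcomp Require Import all_classical all_reals all_analysis.
From mathcomp Require Import normal_distribution.

Set Implicit Arguments.
Unset Strict Implicit.
Unset Printing Implicit Defensive.

Import Order.TTheory GRing.Theory Num.Theory.
Local Open Scope classical_set_scope.
Local Open Scope ring_scope.

Section Aggregation.
Variables (R : realType) (n M : nat).

Definition dotv (u v : 'cV[R]_n) : R := \sum_(i < n) u i 0 * v i 0.
Definition norm2 (v : 'cV[R]_n) : R := Num.sqrt (dotv v v).

Definition opnorm_le1 (A : 'M[R]_n) : Prop :=
  forall v : 'cV[R]_n, norm2 (A *m v) <= norm2 v.

Definition in_simplex (theta : 'I_M -> R) : Prop :=
  (\sum_(j < M) theta j = 1) /\ (forall j, 0 <= theta j).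

Variables (A : 'I_M -> 'M[R]_n) (b : 'I_M -> 'cV[R]_n) (sigma : R).

Definition A_theta (theta : 'I_M -> R) : 'M[R]_n := \sum_(j < M) theta j *: A j.
Definition b_theta (theta : 'I_M -> R) : 'cV[R]_n := \sum_(j < M) theta j *: b j.

Definition mu_j (j : 'I_M) (y : 'cV[R]_n) : 'cV[R]_n := A j *m y + b j.
Definition mu_theta (theta : 'I_M -> R) (y : 'cV[R]_n) : 'cV[R]_n :=
  A_theta theta *m y + b_theta theta.

Definition Cp (theta : 'I_M -> R) (y : 'cV[R]_n) : R :=
  norm2 (mu_theta theta y) ^+ 2 - 2 * dotv y (mu_theta theta y)
  + 2 * sigma ^+ 2 * \tr (A_theta theta).

Definition pen (theta : 'I_M -> R) (y : 'cV[R]_n) : R :=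
  \sum_(j < M) theta j * norm2 (mu_theta theta y - mu_j j y) ^+ 2.

Definition H_pen (theta : 'I_M -> R) (y : 'cV[R]_n) : R :=
  Cp theta y + 2^-1 * pen theta y.

Definition is_argmin_Hpen (theta : 'I_M -> R) (y : 'cV[R]_n) : Prop :=
  in_simplex theta /\
  (forall theta', in_simplex theta' -> H_pen theta y <= H_pen theta' y).

End Aggregation.

(** Mutual independence of a finite family of real random variables:
    product rule for all Borel sets (taking B i = setT for unused indices
    yields the product rule for every subfamily). *)
Definition mutually_independent {d} {T : measurableType d} {R : realType}
    (P : probability T R) (k : nat) (X : 'I_k -> T -> R) : Prop :=
  forall B : 'I_k -> set R, (forall i, measurable (B i)) ->
    P (\bigcap_(i in [set: 'I_k]) (X i @^-1` B i)) =
    (\prod_(i < k) P (X i @^-1` B i))%E.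

(* Main.v *)
(** On the simplex, [H_pen] is half the squared norm of the aggregate plus a
    linear function of the weights, so the first-order condition at a minimizer
    [theta] bounds [|mu_theta - f|^2 - |mu_k - f|^2], for every [k], by the
    [theta]-average over [j] of
      [gap_jk = 2 xi.(mu_j - mu_k) - 2 sigma^2 tr(A_j - A_k)
                - |mu_j - mu_k|^2 / 2],
    hence by [max_j gap_jk].  With [B = A_j - A_k], the negative square pays for
    the Gaussian fluctuations of the first two terms because [|B| <= 2], and
    [E exp(gap_jk / (46 sigma^2)) <= 1].  Both claims follow from summing these
    exponential moments over the [M^2] pairs: Markov's inequality gives the
    deviation bound, and [1 + u <= exp u] the bound in expectation.

    The exponential moment of a Gaussian quadratic form is bounded without
    diagonalization: coordinates are integrated out one at a time, and
    [(1 - 2 q)^(-1/2) <= exp(q + 5/2 q^2)] for [q <= 1/10] makes the trace and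
    the Frobenius norm of the form accumulate in the exponent. *)

Require Import Defs.
From HB Require Import structures.
From mathcomp Require Import all_boot all_order all_algebra.
From mathcomp Require Import all_classical all_reals all_analysis.
From mathcomp Require Import normal_distribution measurable_realfun ring lra.

Set Implicit Arguments.
Unset Strict Implicit.
Unset Printing Implicit Defensive.

Import Order.TTheory GRing.Theory Num.Theory.
Local Open Scope classical_set_scope.
Local Open Scope ring_scope.

(** * One-dimensional Gaussian integrals *)

Section normal_integral.
Context {R : realType}.
Local Notation mu := (@lebesgue_measure R).

(** The Radon-Nikodym derivative of the normal law with respect to Lebesgue measure equals
    [normal_pdf] almost everywhere, because both have the same integral over every measurable
    set. *)
Lemma integral_normal_prob (m s : R) (f : R -> \bar R) :
  measurable_fun setT f -> (forall x, (0 <= f x)%E) ->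
  (\int[normal_prob m s]_x f x =
   \int[mu]_x (f x * (normal_pdf m s x)%:E))%E.
Proof.
move=> mf f0; have dom := normal_prob_dominates m s.
rewrite -(Radon_Nikodym_SigmaFinite.change_of_variables dom)//.
have intf := Radon_Nikodym_SigmaFinite.f_integrable dom.
have mpdf : measurable_fun setT (fun x => (normal_pdf m s x)%:E).
  by apply/measurable_EFinP; exact: measurable_normal_pdf.
apply: ae_eq_integral => //.
- by apply: emeasurable_funM => //; exact: measurable_int intf.
- exact: emeasurable_funM.
- apply: ae_eqe_mul2l; apply: integral_ae_eq => // E _ mE.
  by rewrite -Radon_Nikodym_SigmaFinite.f_integral.
Qed.

Lemma measurable_expR_quadratic (s q t : R) :
  measurable_fun setT (fun x : R => expR (q * (x / s) ^+ 2 + t * (x / s))).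
Proof.
have mxs : measurable_fun setT (fun x : R => x / s) by exact: measurable_funM.
apply: measurableT_comp => //; apply: measurable_funD.
  by apply: measurable_funM => //; exact: measurable_funX.
exact: measurable_funM.
Qed.

(** Completing the square: with [a = 1 - 2 q], the integrand times the density of N(0, s^2) is a
    constant times the density of the normal law with mean [t s / a] and standard deviation
    [s / sqrt a], which integrates to 1. *)
Lemma integral_normal_expR_quadratic (s q t : R) : 0 < s -> q < 2^-1 ->
  (\int[normal_prob 0 s]_x (expR (q * (x / s) ^+ 2 + t * (x / s)))%:E =
   ((Num.sqrt (1 - 2 * q))^-1 * expR (t ^+ 2 / (2 * (1 - 2 * q))))%:E)%E.
Proof.
move=> s0 q12; set a := 1 - 2 * q.
have a0 : 0 < a by rewrite /a; lra.
have sa0 : 0 < Num.sqrt a by rewrite sqrtr_gt0.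
have s1 : s != 0 by rewrite gt_eqF.
have sas : s / Num.sqrt a != 0 by rewrite gt_eqF// divr_gt0.
rewrite integral_normal_prob; last 2 first.
- by apply/measurable_EFinP; exact: measurable_expR_quadratic.
- by move=> x; rewrite lee_fin expR_ge0.
set c := _ * expR _.
transitivity (\int[mu]_x (c%:E *
  (normal_pdf (t * s / a) (s / Num.sqrt a) x)%:E))%E.
  apply: eq_integral => x _; rewrite -!EFinM; congr (_%:E).
  rewrite !normal_pdfE// /c.
  have -> : normal_peak (s / Num.sqrt a) = Num.sqrt a * normal_peak s.
    rewrite /normal_peak exprMn exprVn sqr_sqrtr ?ltW//.
    rewrite -mulrA [a^-1 * _]mulrC mulrA -mulrnAl.
    rewrite sqrtrM; last by rewrite mulrn_wge0// mulr_ge0 ?pi_ge0// sqr_ge0.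
    by rewrite sqrtrV ?ltW// invfM invrK mulrC.
  rewrite /normal_fun.
  rewrite [LHS]mulrC -[LHS]mulrA -expRD.
  rewrite [RHS]mulrACA (mulrA (Num.sqrt a)^-1) mulVf ?gt_eqF// mul1r -expRD.
  congr (_ * expR _).
  have -> : (s / Num.sqrt a) ^+ 2 = s ^+ 2 / a.
    by rewrite exprMn exprVn sqr_sqrtr ?ltW.
  rewrite subr0.
  have a1 : 1 - 2 * q != 0 by rewrite gt_eqF.
  by rewrite /a; field; rewrite s1 a1.
rewrite ge0_integralZl//=.
- by rewrite integral_normal_pdf mule1.
- by apply/measurable_EFinP; exact: measurable_normal_pdf.
- by move=> x _; rewrite lee_fin normal_pdf_ge0.
- by rewrite lee_fin /c mulr_ge0 ?invr_ge0 ?sqrtr_ge0 ?expR_ge0.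
Qed.

End normal_integral.

(** With [u] the exponent, [exp (2 u) >= 1 + 2 q + 5 q^2], and [(1 + 2 q + 5 q^2) (1 - 2 q) = 1 +
    q^2 (1 - 10 q)] is at least 1 because [q <= 1/10]. *)
Lemma invr_sqrt_le_expR (R : realType) (q : R) : q <= 10^-1 ->
  (Num.sqrt (1 - 2 * q))^-1 <= expR (q + 5 / 2 * q ^+ 2).
Proof.
move=> q10; have a0 : 0 < 1 - 2 * q by lra.
set u := q + _.
have h : expR (- u) ^+ 2 <= 1 - 2 * q.
  have p0 : 0 < 1 + 2 * q + 5 * q ^+ 2 by nra.
  rewrite -expRM_natl mulrN expRN.
  apply: (@le_trans _ _ (1 + 2 * q + 5 * q ^+ 2)^-1).
    rewrite lef_pV2 ?posrE ?expR_gt0//; apply: le_trans (expR_ge1Dx _).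
    by rewrite /u; lra.
  by rewrite -[_^-1]mul1r ler_pdivrMr//; nra.
rewrite invf_ple ?posrE ?expR_gt0 ?sqrtr_gt0// -expRN.
by apply: le_trans (ler_wsqrtr h); rewrite sqrtr_sqr ger0_norm ?expR_ge0.
Qed.

(** * Tonelli's theorem for an independent pair *)

Section independent_fubini.
Context {R : realType} {d d1 d2 : measure_display} {Omega : measurableType d}
  {T1 : measurableType d1} {T2 : measurableType d2}.
Variable P : probability Omega R.

(** Measures on a product are determined by rectangles, so the joint law of the pair is the product
    of [nu] and the law of [Y], and Tonelli applies. The law of [X] enters only as [nu], so the
    inner integral is directly one against a normal law in the application. *)
Lemma integral_independent_pair (nu : probability T1 R) (X : Omega -> T1)
    (Y : Omega -> T2) (f : T1 * T2 -> \bar R) :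
  measurable_fun setT X -> measurable_fun setT Y ->
  (forall A B, measurable A -> measurable B ->
    P (X @^-1` A `&` Y @^-1` B) = (nu A * P (Y @^-1` B))%E) ->
  measurable_fun setT f -> (forall z, (0 <= f z)%E) ->
  (\int[P]_w f (X w, Y w) = \int[P]_w \int[nu]_x f (x, Y w))%E.
Proof.
move=> mX mY indXY mf f0.
pose XY w := (X w, Y w).
have mXY : measurable_fun setT XY by exact: measurable_fun_pair.
pose XYm : {mfun Omega >-> (T1 * T2)%type} :=
  HB.pack XY (isMeasurableFun.Build _ _ _ _ _ mXY).
pose Ym : {mfun Omega >-> T2} := HB.pack Y (isMeasurableFun.Build _ _ _ _ _ mY).
have -> : (\int[P]_w f (X w, Y w) = \int[distribution P XYm]_z f z)%E.
  by rewrite ge0_integral_distribution.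
transitivity (\int[nu \x distribution P Ym]_z f z)%E.
  apply: eq_measure_integral => E mE _.
  by apply/esym/product_measure_unique.
transitivity (\int[distribution P Ym]_y fubini_G nu f y)%E.
  exact: (@fubini_tonelli2 _ _ _ _ _ nu (distribution P Ym) f mf f0).
rewrite ge0_integral_distribution//.
  exact: measurable_fun_fubini_tonelli_G.
by move=> y; apply: integral_ge0.
Qed.

End independent_fubini.

(** * Rectangles in tuple spaces, and independence of the first coordinate from the others *)

Section tuple_rectangles.
Context {d : measure_display} {T : measurableType d} {n : nat}.

(** A pi-system generating the product sigma-algebra: finite measures on tuples that agree on it
    coincide. *)
Definition tuple_rectangles : set (set (n.-tuple T)) :=
  [set C | exists2 B : 'I_n -> set T, (forall i, measurable (B i)) &
     C = \bigcap_(i in [set: 'I_n]) (fun t => tnth t i) @^-1` B i].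

Lemma setI_closed_tuple_rectangles : setI_closed tuple_rectangles.
Proof.
move=> _ _ [B mB ->] [C mC ->]; exists (fun i => B i `&` C i).
  by move=> i; exact: measurableI.
by rewrite -bigcapI.
Qed.

Lemma measurable_tuple_rectangles :
  measurable = <<s tuple_rectangles >>.
Proof.
apply/seteqP; split.
- apply: smallest_sub; first exact: smallest_sigma_algebra.
  move=> C; rewrite -bigcup_seq => -[i _ [B mB <-]].
  apply: sub_sigma_algebra; exists (fun j => if j == i then B else setT).
    by move=> j; case: ifP.
  rewrite setTI; apply/seteqP; split => [t Bt j _ /=|t /(_ i I)/=].
    by case: eqP => [->|].
  by rewrite eqxx.
- apply: smallest_sub; first exact: sigma_algebra_measurable.
  move=> _ [B mB ->].
  apply: fin_bigcap_measurable; first exact: finite_finset.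
  move=> i _; rewrite -[X in measurable X]setTI.
  exact: (@measurable_tnth _ T n i measurableT).
Qed.

End tuple_rectangles.

Section independent_head_tail.
Context {R : realType} {d : measure_display} {Omega : measurableType d}.
Variable P : probability Omega R.

(** A tuple rather than a function of the index, so that the tail is a random element of a
    measurable space to which Tonelli applies. *)
Definition tail_tuple {n} (X : 'I_n.+1 -> Omega -> R) (w : Omega) : n.-tuple R :=
  [tuple X (lift ord0 i) w | i < n].

Lemma measurable_tail_tuple n (X : 'I_n.+1 -> Omega -> R) :
  (forall i, measurable_fun setT (X i)) -> measurable_fun setT (tail_tuple X).
Proof.
move=> mX; apply/measurable_fun_tnthP => i.
rewrite (_ : _ \o _ = X (lift ord0 i))//.
by apply/funext => w /=; rewrite tnth_mktuple.
Qed.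

Lemma mutually_independent_tail n (X : 'I_n.+1 -> Omega -> R) :
  mutually_independent P X ->
  mutually_independent P (fun i : 'I_n => X (lift ord0 i)).
Proof.
move=> indX B mB.
(* The whole line at index 0 contributes a factor 1 to the product rule. *)
pose B' i := if unlift ord0 i is Some j then B j else setT.
have := indX B'; rewrite big_ord_recl /B' unlift_none preimage_setT.
rewrite probability_setT mul1e.
under eq_bigr do rewrite liftK.
move=> <-; last by move=> i; case: unliftP.
congr (P _); apply/seteqP; split=> w /= Bw i _.
  by case: unliftP => [j ->|]//; exact: Bw.
by have /= := Bw (lift ord0 i) I; rewrite liftK.
Qed.

(** For fixed [A], both sides are finite measures in [B]. On rectangles they agree by the product
    rule for the full family and for its tail, hence they agree everywhere. *)
Lemma mutually_independent_head_tail n (X : 'I_n.+1 -> Omega -> R) :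
  (forall i, measurable_fun setT (X i)) -> mutually_independent P X ->
  forall A B, measurable A -> measurable B ->
  P (X ord0 @^-1` A `&` tail_tuple X @^-1` B) =
  (P (X ord0 @^-1` A) * P (tail_tuple X @^-1` B))%E.
Proof.
move=> mX indX A B mA mB.
have mXA : measurable (X ord0 @^-1` A).
  by rewrite -[X in measurable X]setTI; exact: mX.
have mY := measurable_tail_tuple mX.
pose Ym : {mfun Omega >-> n.-tuple R} :=
  HB.pack (tail_tuple X) (isMeasurableFun.Build _ _ _ _ _ mY).
have finA : P (X ord0 @^-1` A) \is a fin_num by exact: fin_num_measure.
pose c : {nonneg R} := NngNum (fine_ge0 (measure_ge0 P (X ord0 @^-1` A))).
(* [m1] is the image under the tail of [P] restricted to the event that the head lies in [A]; [m2]
   is the law of the tail scaled by the probability of that event. *)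
pose m1 : {measure set (n.-tuple R) -> \bar R} :=
  measure_function_pushforward__canonical__measure_function_Measure
    (mrestr P mXA) mY.
pose m2 := mscale c (distribution P Ym).
suff : m1 B = m2 B.
  by rewrite /m1 /m2/= /mscale /distribution /pushforward /mrestr/= setIC fineK.
apply: (measure_unique tuple_rectangles (fun _ => setT)) => //.
- exact: measurable_tuple_rectangles.
- exact: setI_closed_tuple_rectangles.
- move=> _; exists (fun _ => setT) => //.
  by apply/seteqP; split.
- by rewrite bigcup_const.
- move=> _ [C mC ->].
  pose tC := \bigcap_(i in [set: 'I_n]) X (lift ord0 i) @^-1` C i.
  have tailE : tail_tuple X @^-1` (\bigcap_(i in [set: 'I_n])
      (fun t => tnth t i) @^-1` C i) = tC.
    apply/seteqP; split=> w /= Cw i _; have := Cw i I;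
    by rewrite /= tnth_mktuple.
  transitivity (P (tC `&` X ord0 @^-1` A)).
    by rewrite /m1/= /pushforward /mrestr tailE.
  transitivity (P (X ord0 @^-1` A) * P tC)%E; last first.
    by rewrite /m2/= /mscale/= fineK// -tailE.
  pose C' i := if unlift ord0 i is Some j then C j else A.
  have -> := mutually_independent_tail indX mC.
  have := indX C'; rewrite big_ord_recl /C' unlift_none.
  under eq_bigr do rewrite liftK.
  move=> <-; last by move=> i; case: unliftP.
  congr (P _); apply/seteqP; split=> w /=.
    by move=> [Cw Aw] i _; case: unliftP => [j ->|->]//; exact: Cw.
  move=> Cw; split; last by have /= := Cw ord0 I; rewrite unlift_none.
  by move=> i _; have /= := Cw (lift ord0 i) I; rewrite liftK.
- move=> _; rewrite /m1/= /pushforward /mrestr/= preimage_setT setTI.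
  by rewrite -ge0_fin_numE.
Qed.

End independent_head_tail.

(** * Linear and quadratic forms, and splitting off their first coordinate *)

Section quadratic_forms.
Context {R : realType}.

(** Coefficients and arguments are plain functions of the index, so that removing index 0 is a mere
    reindexing along [lift ord0]. *)
Definition lform n (u z : 'I_n -> R) : R := \sum_(i < n) u i * z i.

Definition qform n (Q : 'I_n -> 'I_n -> R) (z : 'I_n -> R) : R :=
  \sum_(i < n) \sum_(j < n) Q i j * z i * z j.

Lemma lform0 n (u : 'I_n -> R) : lform u (fun=> 0) = 0.
Proof. by rewrite /lform big1// => i _; rewrite mulr0. Qed.

Lemma qform0 n (Q : 'I_n -> 'I_n -> R) : qform Q (fun=> 0) = 0.
Proof.
by rewrite /qform big1// => i _; rewrite big1// => j _; rewrite mulr0.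
Qed.

Lemma lformDl n (u v z : 'I_n -> R) c :
  lform (fun i => u i + c * v i) z = lform u z + c * lform v z.
Proof.
rewrite /lform mulr_sumr -big_split/=; apply: eq_bigr => i _.
by rewrite mulrDl mulrA.
Qed.

(** Eliminating a coordinate by a Schur complement is a rank-one update; this and [frobenius_rank1]
    follow the form and its Frobenius norm through it. *)
Lemma qform_rank1 n (Q : 'I_n -> 'I_n -> R) c (u z : 'I_n -> R) :
  qform (fun i j => Q i j + c * (u i * u j)) z =
  qform Q z + c * lform u z ^+ 2.
Proof.
rewrite expr2 /lform mulr_suml mulr_sumr -big_split/=.
apply: eq_bigr => i _; rewrite mulr_sumr mulr_sumr -big_split/=.
by apply: eq_bigr => j _; ring.
Qed.

Lemma frobenius_rank1 n (Q : 'I_n -> 'I_n -> R) c (u : 'I_n -> R) :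
  \sum_(i < n) \sum_(j < n) (Q i j + c * (u i * u j)) ^+ 2 =
  \sum_(i < n) \sum_(j < n) Q i j ^+ 2 + 2 * c * qform Q u +
  c ^+ 2 * lform u u ^+ 2.
Proof.
rewrite [lform u u ^+ 2]expr2 /lform mulr_suml !mulr_sumr -!big_split/=.
apply: eq_bigr => i _; rewrite !mulr_sumr -!big_split/=.
by apply: eq_bigr => j _; ring.
Qed.

Definition tailv n (z : 'I_n.+1 -> R) (i : 'I_n) : R := z (lift ord0 i).

Definition tailm n (Q : 'I_n.+1 -> 'I_n.+1 -> R) (i j : 'I_n) : R :=
  Q (lift ord0 i) (lift ord0 j).

Lemma lform_recl n (u z : 'I_n.+1 -> R) :
  lform u z = u ord0 * z ord0 + lform (tailv u) (tailv z).
Proof. by rewrite /lform big_ord_recl. Qed.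

Lemma qform_recl n (Q : 'I_n.+1 -> 'I_n.+1 -> R) z :
  (forall i j, Q i j = Q j i) ->
  qform Q z = Q ord0 ord0 * z ord0 ^+ 2 +
    2 * z ord0 * lform (tailv (Q ord0)) (tailv z) + qform (tailm Q) (tailv z).
Proof.
move=> symQ; rewrite /qform /lform big_ord_recl big_ord_recl.
under [in X in _ + X = _]eq_bigr do rewrite big_ord_recl.
rewrite big_split/= mulr_sumr.
have -> : \sum_(i < n) Q (lift ord0 i) ord0 * z (lift ord0 i) * z ord0 =
    \sum_(i < n) z ord0 * (tailv (Q ord0) i * tailv z i).
  by apply: eq_bigr => i _; rewrite symQ /tailv; ring.
have -> : \sum_(i < n) Q ord0 (lift ord0 i) * z ord0 * z (lift ord0 i) =
    \sum_(i < n) z ord0 * (tailv (Q ord0) i * tailv z i).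
  by apply: eq_bigr => i _; rewrite /tailv; ring.
have -> : \sum_(i < n) 2 * z ord0 * (tailv (Q ord0) i * tailv z i) =
    2 * \sum_(i < n) z ord0 * (tailv (Q ord0) i * tailv z i).
  by rewrite mulr_sumr; apply: eq_bigr => i _; rewrite -mulrA.
by rewrite /tailm /tailv; ring.
Qed.

Lemma frobenius_recl n (Q : 'I_n.+1 -> 'I_n.+1 -> R) :
  (forall i j, Q i j = Q j i) ->
  \sum_i \sum_j Q i j ^+ 2 = Q ord0 ord0 ^+ 2 +
    2 * lform (tailv (Q ord0)) (tailv (Q ord0)) +
    \sum_i \sum_j tailm Q i j ^+ 2.
Proof.
move=> symQ; rewrite /lform big_ord_recl big_ord_recl.
under [in X in _ + X = _]eq_bigr do rewrite big_ord_recl.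
rewrite big_split/=.
have -> : \sum_(i < n) Q (lift ord0 i) ord0 ^+ 2 =
    \sum_(i < n) tailv (Q ord0) i * tailv (Q ord0) i.
  by apply: eq_bigr => i _; rewrite symQ /tailv expr2.
have -> : \sum_(i < n) Q ord0 (lift ord0 i) ^+ 2 =
    \sum_(i < n) tailv (Q ord0) i * tailv (Q ord0) i.
  by apply: eq_bigr => i _; rewrite /tailv expr2.
by rewrite /tailm; ring.
Qed.

Definition consv n (x : R) (z : 'I_n -> R) (i : 'I_n.+1) : R :=
  oapp z x (unlift ord0 i).

Lemma consv0 n x (z : 'I_n -> R) : consv x z ord0 = x.
Proof. by rewrite /consv unlift_none. Qed.

Lemma tailv_consv n x (z : 'I_n -> R) : tailv (consv x z) = z.
Proof. by apply/funext => i; rewrite /tailv /consv liftK. Qed.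

Lemma lform_ge0 n (z : 'I_n -> R) : 0 <= lform z z.
Proof. by apply: sumr_ge0 => i _; rewrite -expr2 sqr_ge0. Qed.

Section measurable_forms.
Context {d : measure_display} {T : measurableType d} {n : nat}.
Variable z : T -> 'I_n -> R.
Hypothesis mz : forall i, measurable_fun setT (fun t => z t i).

Lemma measurable_lform u : measurable_fun setT (fun t => lform u (z t)).
Proof. by apply: measurable_sum => i; exact: measurable_funM. Qed.

Lemma measurable_qform Q : measurable_fun setT (fun t => qform Q (z t)).
Proof.
apply: measurable_sum => i; apply: measurable_sum => j.
by apply: measurable_funM => //; exact: measurable_funM.
Qed.

End measurable_forms.

End quadratic_forms.

(** * Exponential moment of a Gaussian quadratic form *)

Section gaussian_mgf.
Context {R : realType} {d : measure_display} {Omega : measurableType d}.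
Variables (P : probability Omega R) (s : R).
Hypothesis s_gt0 : 0 < s.

(* The first coordinate is integrated out: [I - 2 Q] is replaced by its Schur
   complement, which preserves the bound on [Q] and leaves in [K] exactly the
   part of [w^T (I - 2 Q)^-1 w] not yet accounted for. *)
Lemma gaussian_quadratic_mgf n (X : 'I_n -> Omega -> R)
    (Q : 'I_n -> 'I_n -> R) (w : 'I_n -> R) (K : R) :
  (forall i, measurable_fun setT (X i)) ->
  (forall i B, measurable B -> P (X i @^-1` B) = normal_prob 0 s B) ->
  mutually_independent P X ->
  (forall i j, Q i j = Q j i) ->
  (forall z, qform Q z <= 10^-1 * lform z z) ->
  (forall z, 2 * lform w z + 2 * qform Q z - lform z z <= K) ->
  (\int[P]_t (expR (qform Q (fun i => X i t / s) +
                    lform w (fun i => X i t / s)))%:E <=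
   (expR (\sum_i Q i i + 5 / 2 * \sum_i \sum_j Q i j ^+ 2 + K / 2))%:E)%E.
Proof.
elim: n => [|n IHn] in X Q w K *.
  (* In dimension 0 the hypothesis on [K] says [0 <= K], and the integral is 1. *)
  move=> mX lawX indX symQ Qle /(_ (fun=> 0)).
  rewrite /lform /qform !big_ord0 !mulr0 subr0 addr0 => K0.
  under eq_integral do rewrite !big_ord0 addr0 expR0.
  rewrite integral_cst//= probability_setT mule1 lee_fin.
  by rewrite -[leLHS]expR0 ler_expR; lra.
move=> mX lawX indX symQ Qle wK.
set q := Q ord0 ord0; set r := tailv (Q ord0); set a := 1 - 2 * q.
have Qxz x z : q * x ^+ 2 + 2 * x * lform r z + qform (tailm Q) z <=
    10^-1 * (x ^+ 2 + lform z z).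
  have := Qle (consv x z).
  by rewrite qform_recl// lform_recl consv0 tailv_consv -/q -/r expr2.
have wKxz x z : 2 * (w ord0 * x + lform (tailv w) z) +
    2 * (q * x ^+ 2 + 2 * x * lform r z + qform (tailm Q) z) -
    (x ^+ 2 + lform z z) <= K.
  have := wK (consv x z).
  by rewrite qform_recl// !lform_recl consv0 tailv_consv -/q -/r expr2.
(* The bound on the form is tested at the first basis vector. *)
have q10 : q <= 10^-1.
  have := Qxz 1 (fun=> 0).
  by rewrite qform0 !lform0; lra.
have a0 : 0 < a by rewrite /a; lra.
have a1 : a != 0 by rewrite gt_eqF.
pose Q2 i j := tailm Q i j + 2 / a * (r i * r j).
pose w2 i := tailv w i + 2 * w ord0 / a * r i.
pose K2 := K - w ord0 ^+ 2 / a.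
have Q2le z : qform Q2 z <= 10^-1 * lform z z.
  rewrite /Q2 qform_rank1.
  (* The head coordinate [2 L / a] maximizes [q x^2 + 2 x L - x^2 / 2], with maximum [2 L^2 / a],
     the rank-one term of [Q2]. Replacing [x^2 / 2] by [x^2 / 10] only leaves a nonnegative
     surplus. *)
  have := Qxz (2 / a * lform r z) z; set L := lform r z.
  suff : 2 / a * L ^+ 2 <= q * (2 / a * L) ^+ 2 + 2 * (2 / a * L) * L -
    10^-1 * (2 / a * L) ^+ 2 by lra.
  have -> : q * (2 / a * L) ^+ 2 + 2 * (2 / a * L) * L -
      10^-1 * (2 / a * L) ^+ 2 =
      2 / a * L ^+ 2 + 4 * (2^-1 - 10^-1) * (L / a) ^+ 2.
    by rewrite /a in a1 *; field.
  by rewrite lerDl mulr_ge0 ?sqr_ge0//; lra.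
have w2K z : 2 * lform w2 z + 2 * qform Q2 z - lform z z <= K2.
  rewrite /w2 /Q2 qform_rank1 lformDl /K2.
  (* Here the head coordinate maximizes [2 (2 L + w_0) x - a x^2]. The maximum [(2 L + w_0)^2 / a]
     expands into the three corrections defining [Q2], [w2] and [K2]. *)
  have := wKxz ((2 * lform r z + w ord0) / a) z; set L := lform r z.
  move=> H; rewrite lerBrDr; apply: le_trans H.
  rewrite le_eqVlt; apply/orP; left; apply/eqP.
  by rewrite /a in a1 *; field.
have IH := IHn _ Q2 w2 K2 (fun i => mX (lift ord0 i))
  (fun i => lawX (lift ord0 i)) (mutually_independent_tail indX).
have symQ2 i j : Q2 i j = Q2 j i by rewrite /Q2 /tailm symQ [r i * _]mulrC.
have {}IH := IH symQ2 Q2le w2K.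
have zE t i : tailv (fun i => X i t / s) i = tnth (tail_tuple X t) i / s.
  by rewrite tnth_mktuple.
pose zt (t : n.-tuple R) i := tnth t i / s.
pose T0 z := 2 * lform r z + w ord0.
pose G z := qform (tailm Q) z + lform (tailv w) z.
pose f (p : measurableTypeR R * n.-tuple R) : \bar R :=
  (expR (q * (p.1 / s) ^+ 2 + T0 (zt p.2) * (p.1 / s)) * expR (G (zt p.2)))%:E.
have mzt i : measurable_fun setT
    (fun p : measurableTypeR R * n.-tuple R => zt p.2 i).
  apply: measurable_funM => //.
  apply: (@measurableT_comp _ _ _ _ _ _ (fun t : n.-tuple R => tnth t i)) => //.
  exact: measurable_tnth.
have mf : measurable_fun setT f.
  have mp1 : measurable_fun setT
      (fun p : measurableTypeR R * n.-tuple R => p.1 / s).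
    exact: measurable_funM.
  apply/measurable_EFinP; apply: measurable_funM; apply: measurableT_comp => //.
    apply: measurable_funD; apply: measurable_funM => //.
      exact: measurable_funX.
    apply: measurable_funD => //; apply: measurable_funM => //.
    exact: measurable_lform.
  apply: measurable_funD; first exact: measurable_qform.
  exact: measurable_lform.
have -> : (\int[P]_t (expR (qform Q (fun i => X i t / s) +
    lform w (fun i => X i t / s)))%:E =
    \int[P]_t f (X ord0 t, tail_tuple X t))%E.
  apply: eq_integral => t _; rewrite /f/= -expRD; congr (expR _)%:E.
  rewrite qform_recl// lform_recl -/q -/r /G /T0.
  have -> : tailv (fun i => X i t / s) = zt (tail_tuple X t) by exact/funext/zE.
  by ring.
have f0 p : (0 <= f p)%E by rewrite lee_fin mulr_ge0 ?expR_ge0.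
have indht (A : set (measurableTypeR R)) (B : set (n.-tuple R)) :
    measurable A -> measurable B ->
    P (X ord0 @^-1` A `&` tail_tuple X @^-1` B) =
    (normal_prob 0 s A * P (tail_tuple X @^-1` B))%E.
  by move=> mA mB; rewrite mutually_independent_head_tail// lawX.
rewrite (integral_independent_pair (nu := normal_prob 0 s) (mX ord0)
  (measurable_tail_tuple mX) indht mf f0).
(* The head integral gives [exp (T0^2 / (2 a))] with [T0 = 2 L + w_0]. The terms in [L^2] and [L]
   turn the tail forms into those of [Q2] and [w2]; [c] keeps the part free of the tail. *)
pose c := (Num.sqrt a)^-1 * expR (w ord0 ^+ 2 / (2 * a)).
have c0 : 0 <= c by rewrite mulr_ge0 ?invr_ge0 ?sqrtr_ge0 ?expR_ge0.
have -> : (\int[P]_t \int[normal_prob 0 s]_x f (x, tail_tuple X t) =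
    \int[P]_t (c%:E * (expR (qform Q2 (fun i => X (lift ord0 i) t / s) +
      lform w2 (fun i => X (lift ord0 i) t / s)))%:E))%E.
  apply: eq_integral => t _; rewrite /f/=.
  under eq_integral do rewrite EFinM.
  rewrite ge0_integralZr//; last first.
    by apply/measurable_EFinP; exact: measurable_expR_quadratic.
  rewrite integral_normal_expR_quadratic//; last by lra.
  rewrite -!EFinM; congr (_%:E); rewrite /c -!mulrA -!expRD.
  congr (_ * expR _).
  have -> : (fun i => X (lift ord0 i) t / s) = zt (tail_tuple X t).
    exact/funext/zE.
  rewrite /T0 /G /Q2 /w2 qform_rank1 lformDl -/a.
  by field.
rewrite ge0_integralZl//; last first.
  apply/measurable_EFinP; apply: measurableT_comp => //.
  have mz i : measurable_fun setT (fun t => X (lift ord0 i) t / s).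
    exact: measurable_funM.
  by apply: measurable_funD; [exact: measurable_qform|exact: measurable_lform].
apply: le_trans.
  by apply: lee_wpmul2l IH; rewrite lee_fin.
rewrite -EFinM lee_fin /c -(mulrA (Num.sqrt a)^-1) -expRD.
apply: (@le_trans _ _ (expR (q + 5 / 2 * q ^+ 2) * expR (w ord0 ^+ 2 / (2 * a) +
  (\sum_i Q2 i i + 5 / 2 * \sum_i \sum_j Q2 i j ^+ 2 + K2 / 2)))).
  by rewrite ler_wpM2r ?expR_ge0// invr_sqrt_le_expR.
rewrite -expRD ler_expR frobenius_recl// -/q -/r big_ord_recl -/q.
rewrite /Q2 frobenius_rank1 big_split/= -mulr_sumr -/(lform r r) /K2.
rewrite -[\sum_(i < n) tailm Q i i]/(\sum_(i < n) Q (lift ord0 i) (lift ord0 i)).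
set F := \sum_(i < n) \sum_(j < n) _; set Tr := \sum_(i < n) Q _ _.
(* After cancellation the claim is [2 rr / a + 10 A / a + 10 rr^2 / a^2 <= 5 rr]. The bound on [Q2]
   at [r], namely [A + 2 rr^2 / a <= rr / 10], makes the left side at most [3 rr / a], and
   [1 / a <= 5 / 4]. *)
have := Q2le r; rewrite /Q2 qform_rank1.
set A := qform _ r; have := lform_ge0 r; set rr := lform r r => rr0 Ale.
have ia0 : 0 < a^-1 by rewrite invr_gt0.
have ia : a^-1 <= 5 / 4.
  by rewrite -[a^-1]mul1r ler_pdivrMr// /a; lra.
have -> : w ord0 ^+ 2 / (2 * a) = w ord0 ^+ 2 / a / 2 by field.
have H1 := ler_wpM2l (ltW ia0) Ale.
have H2 := ler_wpM2r rr0 ia.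
have H3 : 0 <= (a^-1 * rr) ^+ 2 by rewrite sqr_ge0.
nra.
Qed.

End gaussian_mgf.

(** * Inner products, Frobenius norms and the matrix of the gap *)

Section dot_product.
Context {R : realType} {n : nat}.
Implicit Types (u v x : 'cV[R]_n) (B : 'M[R]_n).

Lemma dotvE u v : dotv u v = (u^T *m v) 0 0.
Proof. by rewrite mxE; apply: eq_bigr => i _; rewrite mxE. Qed.

Lemma dotvC u v : dotv u v = dotv v u.
Proof. by apply: eq_bigr => i _; rewrite mulrC. Qed.

Lemma dotvDr u v x : dotv u (v + x) = dotv u v + dotv u x.
Proof. by rewrite !dotvE mulmxDr mxE. Qed.

Lemma dotvZr c u v : dotv u (c *: v) = c * dotv u v.
Proof. by rewrite !dotvE -scalemxAr mxE. Qed.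

Lemma dotvNr u v : dotv u (- v) = - dotv u v.
Proof. by rewrite -scaleN1r dotvZr mulN1r. Qed.

Lemma dotvDl u v x : dotv (u + v) x = dotv u x + dotv v x.
Proof. by rewrite dotvC dotvDr !(dotvC x). Qed.

Lemma dotvZl c u v : dotv (c *: u) v = c * dotv u v.
Proof. by rewrite dotvC dotvZr dotvC. Qed.

Lemma dotvNl u v : dotv (- u) v = - dotv u v.
Proof. by rewrite dotvC dotvNr dotvC. Qed.

Definition dotv_linear := (dotvDl, dotvNl, dotvZl, dotvDr, dotvNr, dotvZr).

Lemma dotvDD u v : dotv (u + v) (u + v) = dotv u u + 2 * dotv u v + dotv v v.
Proof. by rewrite !dotv_linear (dotvC v u); ring. Qed.

Lemma dotvBB u v : dotv (u - v) (u - v) = dotv u u - 2 * dotv u v + dotv v v.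
Proof. by rewrite dotvDD dotvNr dotvNl dotvNr; ring. Qed.

Lemma dotv_sumr u I (r : seq I) (F : I -> 'cV[R]_n) :
  dotv u (\sum_(j <- r) F j) = \sum_(j <- r) dotv u (F j).
Proof.
elim: r => [|j r IH]; last by rewrite !big_cons dotvDr IH.
by rewrite !big_nil -(scale0r 0) dotvZr mul0r.
Qed.

Lemma dotv_trmx B u v : dotv u (B^T *m v) = dotv (B *m u) v.
Proof. by rewrite !dotvE trmx_mul mulmxA. Qed.

Lemma dotv_ge0 u : 0 <= dotv u u.
Proof. by apply: sumr_ge0 => i _; rewrite -expr2 sqr_ge0. Qed.

Lemma sqr_norm2 u : norm2 u ^+ 2 = dotv u u.
Proof. by rewrite sqr_sqrtr// dotv_ge0. Qed.

Lemma opnorm_le1_dotv B : opnorm_le1 B ->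
  forall u, dotv (B *m u) (B *m u) <= dotv u u.
Proof.
move=> HB u; rewrite -!sqr_norm2 ler_sqr ?nnegrE ?sqrtr_ge0//; exact: HB.
Qed.

(** From [|p - q|^2 <= 2 |p|^2 + 2 |q|^2]. *)
Lemma dotv_sub_le (A1 A2 : 'M[R]_n) : opnorm_le1 A1 -> opnorm_le1 A2 ->
  forall u, dotv ((A1 - A2) *m u) ((A1 - A2) *m u) <= 4 * dotv u u.
Proof.
move=> /opnorm_le1_dotv H1 /opnorm_le1_dotv H2 u; rewrite mulmxBl.
have := dotv_ge0 (A1 *m u + A2 *m u).
rewrite !dotv_linear (dotvC (A2 *m u) (A1 *m u)); move: (H1 u) (H2 u); lra.
Qed.

Definition frobenius B : R := \sum_i \sum_j B i j ^+ 2.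

Lemma frobenius_ge0 B : 0 <= frobenius B.
Proof. by apply: sumr_ge0 => i _; apply: sumr_ge0 => j _; rewrite sqr_ge0. Qed.

Lemma frobenius_trmx B : frobenius B^T = frobenius B.
Proof.
rewrite /frobenius exchange_big; apply: eq_bigr => i _.
by apply: eq_bigr => j _; rewrite mxE.
Qed.

Lemma frobenius_col B : frobenius B = \sum_j dotv (col j B) (col j B).
Proof.
rewrite /frobenius exchange_big; apply: eq_bigr => j _.
by apply: eq_bigr => i _; rewrite !mxE expr2.
Qed.

Section opnorm2.
Variable B : 'M[R]_n.
Hypothesis HB : forall u, dotv (B *m u) (B *m u) <= 4 * dotv u u.

(** The transpose inherits the norm bound without spectral theory: expand [|B B^T u - 4 u|^2 >= 0]
    and bound [|B B^T u|^2] by [4 |B^T u|^2]. *)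
Lemma dotv_trmx_le u : dotv (B^T *m u) (B^T *m u) <= 4 * dotv u u.
Proof.
have := HB (B^T *m u); have := dotv_ge0 (B *m (B^T *m u) - 4 *: u).
by rewrite !dotv_linear (dotvC u (_ *m _)) -(dotv_trmx _ _ u); lra.
Qed.

(** Column by column: column [j] of [B^T B] is [B^T] applied to column [j] of [B]. *)
Lemma frobenius_gram : frobenius (B^T *m B) <= 4 * frobenius B.
Proof.
rewrite !frobenius_col mulr_sumr; apply: ler_sum => j _.
by rewrite !colE -mulmxA dotv_trmx_le.
Qed.

(** The symmetric matrix of the quadratic form [2 u.(B u) - |B u|^2 / 2], the part of the gap that
    is quadratic in the noise. *)
Definition gap_mx : 'M[R]_n := B + B^T - 2^-1 *: (B^T *m B).

Lemma gap_mx_sym i j : gap_mx i j = gap_mx j i.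
Proof.
rewrite /gap_mx !mxE [B i j + _]addrC; congr (_ - _ * _).
by apply: eq_bigr => k _; rewrite !mxE mulrC.
Qed.

(** Entrywise, [(x + y - g / 2)^2 <= 3 x^2 + 3 y^2 + 3/4 g^2]. Summing gives 6 Frobenius norms of
    [B] plus 3/4 of that of [B^T B], hence [6 + 3 = 9]. *)
Lemma frobenius_gap : frobenius gap_mx <= 9 * frobenius B.
Proof.
have : frobenius gap_mx <= 3 * (frobenius B + frobenius B^T) +
    3 / 4 * frobenius (B^T *m B).
  rewrite /frobenius -big_split/= !mulr_sumr -big_split/=.
  apply: ler_sum => i _; rewrite -big_split/= !mulr_sumr -big_split/=.
  apply: ler_sum => j _.
  rewrite /gap_mx !mxE; set x := B i j; set y := B j i; set g := \sum_k _.
  have := sqr_ge0 (x - y); have := sqr_ge0 (x + y + g); nra.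
rewrite frobenius_trmx; have := frobenius_gram; lra.
Qed.

Lemma gap_mx_dotv u :
  dotv u (gap_mx *m u) = 2 * dotv u (B *m u) - 2^-1 * dotv (B *m u) (B *m u).
Proof.
rewrite /gap_mx mulmxBl mulmxDl -scalemxAl -mulmxA !dotv_linear !dotv_trmx.
by rewrite (dotvC (B *m u)); ring.
Qed.

Lemma mxtrace_gap : \tr gap_mx = 2 * \tr B - 2^-1 * frobenius B.
Proof.
rewrite /gap_mx raddfB raddfD/= mxtrace_tr mxtraceZ.
have -> : \tr (B^T *m B) = frobenius B.
  rewrite frobenius_col; apply: eq_bigr => j _; rewrite mxE.
  by apply: eq_bigr => i _; rewrite !mxE.
ring.
Qed.

End opnorm2.

End dot_product.

(** * Exponential moment of the gap between two estimators *)

Section gaussian_gap.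
Context {R : realType} {d : measure_display} {Omega : measurableType d}.
Variables (P : probability Omega R) (s : R) (n : nat).
Hypothesis s_gt0 : 0 < s.
Variable X : 'I_n -> Omega -> R.
Hypothesis mX : forall i, measurable_fun setT (X i).
Hypothesis lawX :
  forall i B, measurable B -> P (X i @^-1` B) = normal_prob 0 s B.
Hypothesis indX : mutually_independent P X.

(** For [B = A_j - A_k] and [v = B f + b_j - b_k], the vector [B z + v] at the noise [z] is
    [mu_j - mu_k]. *)
Definition gap (B : 'M[R]_n) (v z : 'cV[R]_n) : R :=
  2 * dotv z (B *m z + v) - 2 * s ^+ 2 * \tr B -
  2^-1 * dotv (B *m z + v) (B *m z + v).

(** The trace and [v] terms cancel against the bound of [gaussian_quadratic_mgf]. With [F] the
    Frobenius norm squared of [B], what remains in the exponent is at most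
    [- F / (2 * 46) + (5/2) * 9 F / 46^2], which is nonpositive since [45 <= 46]. *)
Lemma gaussian_gap_mgf (B : 'M[R]_n) (v : 'cV[R]_n) :
  (forall u, dotv (B *m u) (B *m u) <= 4 * dotv u u) ->
  (\int[P]_t (expR ((46 * s ^+ 2)^-1 * gap B v (\col_i X i t)))%:E <= 1)%E.
Proof.
move=> HB; have s1 : s != 0 by rewrite gt_eqF.
have [v' v'E] : exists v', v' = s^-1 *: v by exists (s^-1 *: v).
pose Q i j := 46^-1 * gap_mx B i j.
pose w i := 46^-1 * (2 *: v' - B^T *m v') i 0.
have colK (z : 'I_n -> R) : lform z z = dotv (\col_i z i) (\col_i z i).
  by apply: eq_bigr => i _; rewrite !mxE.
have QE z : qform Q z = 46^-1 * (2 * dotv (\col_i z i) (B *m \col_i z i) -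
    2^-1 * dotv (B *m \col_i z i) (B *m \col_i z i)).
  rewrite -gap_mx_dotv /qform /dotv mulr_sumr; apply: eq_bigr => i _.
  rewrite [(gap_mx B *m _) i 0]mxE !mulr_sumr; apply: eq_bigr => j _.
  by rewrite /Q !mxE; ring.
have wE z : lform w z = 46^-1 * (2 * dotv v' (\col_i z i) -
    dotv v' (B *m \col_i z i)).
  rewrite (dotvC v' (_ *m _)) -dotv_trmx (dotvC _ (_ *m _)) -dotvZl.
  rewrite -dotvNl -dotvDl /lform /dotv mulr_sumr; apply: eq_bigr => i _.
  by rewrite /w [(\col__ _) i 0]mxE mulrA.
have symQ i j : Q i j = Q j i by rewrite /Q gap_mx_sym.
have Qle z : qform Q z <= 10^-1 * lform z z.
  rewrite QE colK; set u := \col_i z i.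
  (* Expanding [|B u - 2 u|^2 >= 0] bounds the form by [2 |u|^2 / 46]. *)
  have := dotv_ge0 (B *m u - 2 *: u); have := dotv_ge0 u.
  rewrite !dotv_linear (dotvC (B *m u) u); lra.
pose K := 46^-1 * dotv v' v'.
have wK z : 2 * lform w z + 2 * qform Q z - lform z z <= K.
  rewrite QE wE colK /K; set u := \col_i z i.
  (* Expanding this square bounds the left side by [(|v'|^2 + 4 |u|^2) / 46 - |u|^2], which is at
     most [K]. *)
  have := dotv_ge0 (v' + B *m u - 2 *: u); have := dotv_ge0 u.
  rewrite !dotv_linear (dotvC (B *m u) u) (dotvC u v') (dotvC (B *m u) v').
  lra.
have := gaussian_quadratic_mgf s_gt0 mX lawX indX symQ Qle wK.
set E := (X in (expR X)%:E) => IH.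
(* The part of the scaled gap that does not depend on the noise. *)
pose c := - (46^-1 * (2 * \tr B + 2^-1 * dotv v' v')).
have -> : (\int[P]_t (expR ((46 * s ^+ 2)^-1 * gap B v (\col_i X i t)))%:E =
    \int[P]_t ((expR c)%:E * (expR (qform Q (fun i => X i t / s) +
      lform w (fun i => X i t / s)))%:E))%E.
  apply: eq_integral => t _; rewrite -EFinM -expRD; congr (expR _)%:E.
  rewrite QE wE; have -> : \col_i (X i t / s) = s^-1 *: \col_i X i t.
    by apply/colP => i; rewrite !mxE mulrC.
  set z := \col_i X i t; rewrite /gap /c v'E -scalemxAr !dotv_linear.
  by rewrite (dotvC (B *m z) v) (dotvC z v); field.
rewrite ge0_integralZl//; last first.
  apply/measurable_EFinP; apply: measurableT_comp => //.
  have mz i : measurable_fun setT (fun t => X i t / s).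
    exact: measurable_funM.
  by apply: measurable_funD; [exact: measurable_qform|exact: measurable_lform].
apply: le_trans.
  by apply: lee_wpmul2l IH; rewrite lee_fin expR_ge0.
rewrite -EFinM lee_fin -expRD -[leRHS]expR0 ler_expR.
have -> : E = 46^-1 * \tr (gap_mx B) +
    5 / 2 * (46^-1 ^+ 2 * frobenius (gap_mx B)) + K / 2.
  rewrite /E /Q -mulr_sumr; congr (_ + _ * _ + _).
  rewrite /frobenius mulr_sumr; apply: eq_bigr => i _.
  by rewrite mulr_sumr; apply: eq_bigr => j _; rewrite exprMn.
rewrite mxtrace_gap /c /K.
have := frobenius_gap HB; have := frobenius_ge0 B.
by rewrite expr2; lra.
Qed.

End gaussian_gap.

(** * Deterministic oracle inequality for a minimizer of the criterion *)

Section oracle_inequality.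
Context {R : realType} {n M : nat}.
Variables (A : 'I_M -> 'M[R]_n) (b : 'I_M -> 'cV[R]_n) (sigma : R).
Variable y : 'cV[R]_n.
Implicit Type theta : 'I_M -> R.

Let mu j := mu_j A b j y.

Lemma mu_thetaE theta : mu_theta A b theta y = \sum_j theta j *: mu j.
Proof.
rewrite /mu_theta /A_theta /b_theta mulmx_suml -big_split/=.
by apply: eq_bigr => j _; rewrite scalerDr scalemxAl.
Qed.

Lemma dotv_mu_theta u theta :
  dotv u (mu_theta A b theta y) = \sum_j theta j * dotv u (mu j).
Proof.
by rewrite mu_thetaE dotv_sumr; apply: eq_bigr => j _; rewrite dotvZr.
Qed.

Definition Hlin j : R :=
  2^-1 * dotv (mu j) (mu j) - 2 * dotv y (mu j) + 2 * sigma ^+ 2 * \tr (A j).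

Lemma sum_Hlin theta : \sum_j theta j * Hlin j =
  2^-1 * \sum_j theta j * dotv (mu j) (mu j) -
  2 * dotv y (mu_theta A b theta y) +
  2 * sigma ^+ 2 * \sum_j theta j * \tr (A j).
Proof.
rewrite dotv_mu_theta !mulr_sumr -sumrB -big_split/=.
by apply: eq_bigr => j _; rewrite /Hlin; ring.
Qed.

Lemma sum_cst theta c : in_simplex theta -> \sum_j theta j * c = c.
Proof. by move=> [theta1 _]; rewrite -mulr_suml theta1 mul1r. Qed.

Lemma sum_sqdist theta u : in_simplex theta ->
  \sum_j theta j * dotv (mu j - u) (mu j - u) =
  \sum_j theta j * dotv (mu j) (mu j) -
  2 * dotv u (mu_theta A b theta y) + dotv u u.
Proof.
move=> /sum_cst sumc; rewrite dotv_mu_theta -(sumc (dotv u u)).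
rewrite mulr_sumr -sumrB -big_split/=; apply: eq_bigr => j _.
by rewrite dotvBB (dotvC (mu j) u); ring.
Qed.

(** By [sum_sqdist] at the aggregate, the penalty is the average of [|mu_j|^2] minus [|mu_theta|^2].
    Half of it halves the quadratic term of [Cp] and puts [|mu_j|^2 / 2] into [Hlin]. *)
Lemma H_penE theta : in_simplex theta ->
  H_pen A b sigma theta y =
  2^-1 * dotv (mu_theta A b theta y) (mu_theta A b theta y) +
  \sum_j theta j * Hlin j.
Proof.
move=> th; rewrite /H_pen /Cp /pen sqr_norm2.
under eq_bigr => j _.
  rewrite sqr_norm2 -[mu_theta _ _ _ _ - _]opprB dotvNl dotvNr opprK.
  over.
rewrite sum_sqdist//.
have -> : \tr (A_theta A theta) = \sum_j theta j * \tr (A j).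
  by rewrite /A_theta raddf_sum/=; apply: eq_bigr => j _; rewrite mxtraceZ.
rewrite sum_Hlin; lra.
Qed.

(** First-order condition along the segment from [theta] to the vertex [k]: a step [s] changes the
    criterion by [s (D + s E / 2)], so [D] cannot be negative. *)
Lemma argmin_Hpen_variational theta k : is_argmin_Hpen A b sigma theta y ->
  0 <= dotv (mu_theta A b theta y) (mu k - mu_theta A b theta y) +
       (Hlin k - \sum_j theta j * Hlin j).
Proof.
move=> [th min_th]; set m := mu_theta A b theta y; set L := \sum_j _.
set D := (X in 0 <= X); set E := dotv (mu k - m) (mu k - m).
have E0 : 0 <= E by exact: dotv_ge0.
have step s : 0 < s <= 1 -> 0 <= D + s * (2^-1 * E).
  move=> /andP[s0 s1]; pose theta' j := (1 - s) * theta j + s * (j == k)%:R.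
  have sumE (F : 'I_M -> R) :
      \sum_j theta' j * F j = (1 - s) * (\sum_j theta j * F j) + s * F k.
    rewrite mulr_sumr (bigD1 k)//= [in RHS](bigD1 k)//= /theta' eqxx.
    under eq_bigr => j /negPf jk do rewrite jk mulr0 addr0 -mulrA.
    by rewrite -[true%:R]/(1 : R); ring.
  have th' : in_simplex theta'.
    split=> [|j]; last first.
      case: th => _ th0.
      by rewrite addr_ge0 ?mulr_ge0 ?ler0n ?subr_ge0 ?(ltW s0).
    have := sumE (fun=> 1); under eq_bigr do rewrite mulr1.
    by move=> ->; under eq_bigr do rewrite mulr1; rewrite (proj1 th); ring.
  have mE u : dotv u (mu_theta A b theta' y) = dotv u (m + s *: (mu k - m)).
    rewrite dotv_mu_theta sumE -dotv_mu_theta -/m (dotvDr u m) (dotvZr s).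
    by rewrite (dotvDr u (mu k)) (dotvNr u m); ring.
  have := min_th _ th'; rewrite !H_penE// sumE -/L -/m.
  rewrite mE dotvC mE (dotvDD m) (dotvZr s) (dotvZl s) (dotvZr s) -/E => H.
  have : 0 <= s * (D + s * (2^-1 * E)).
    by move: H; rewrite /D; lra.
  by rewrite pmulr_rge0.
have [//|D0] := leP 0 D.
(* If [D < 0], this explicit step replaces a limit: [s (E + 1) <= - D] forces [D + s E / 2 < 0]. The
   [+ 1] keeps the denominator positive. *)
have s01 : 0 < Num.min 1 (- D / (E + 1)) <= 1.
  by rewrite ge_min lexx/= lt_min ltr01/= divr_gt0 ?oppr_gt0// ltr_wpDl.
have := step _ s01.
have : Num.min 1 (- D / (E + 1)) * (E + 1) <= - D.
  by rewrite -ler_pdivlMr ?ltr_wpDl// ge_min lexx orbT.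
move/andP: s01 => [s0 _]; set s := Num.min _ _ in s0 *.
have := mulr_ge0 (ltW s0) E0; lra.
Qed.

(** Once [y = f + xi] is substituted, the right side minus the left side is exactly the quantity
    that [argmin_Hpen_variational] shows to be nonnegative. *)
Lemma argmin_Hpen_oracle theta f xi k : y = f + xi ->
  is_argmin_Hpen A b sigma theta y ->
  norm2 (mu_theta A b theta y - f) ^+ 2 <= norm2 (mu k - f) ^+ 2 +
   \sum_j theta j * gap sigma (A j - A k) ((A j - A k) *m f + (b j - b k)) xi.
Proof.
move=> yE th; have := argmin_Hpen_variational k th.
have sumc c := @sum_cst _ c (proj1 th).
have gapE j : gap sigma (A j - A k) ((A j - A k) *m f + (b j - b k)) xi =
    2 * dotv xi (mu j - mu k) - 2 * sigma ^+ 2 * (\tr (A j) - \tr (A k)) -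
    2^-1 * dotv (mu j - mu k) (mu j - mu k).
  rewrite /gap; have -> : (A j - A k) *m xi + ((A j - A k) *m f + (b j - b k)) =
      mu j - mu k.
    rewrite addrA [_ *m xi + _]addrC -mulmxDr -yE mulmxBl /mu /mu_j.
    by rewrite opprD addrACA.
  by rewrite raddfB.
have -> : \sum_j theta j *
    gap sigma (A j - A k) ((A j - A k) *m f + (b j - b k)) xi =
    2 * dotv xi (mu_theta A b theta y - mu k) -
    2 * sigma ^+ 2 * (\sum_j theta j * \tr (A j) - \tr (A k)) -
    2^-1 * \sum_j theta j * dotv (mu j - mu k) (mu j - mu k).
  rewrite (dotvDr xi) (dotvNr xi) dotv_mu_theta -(sumc (dotv xi (mu k))).
  rewrite -(sumc (\tr (A k))) -!sumrB !mulr_sumr -!sumrB.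
  apply: eq_bigr => j _.
  by rewrite gapE (dotvDr xi (mu j)) (dotvNr xi (mu k)); ring.
rewrite sum_sqdist; last by case: th.
rewrite sum_Hlin !sqr_norm2 /Hlin; set m := mu_theta A b theta y.
rewrite (dotvDr m (mu k)) (dotvNr m m) (dotvDr xi m) (dotvNr xi (mu k)).
rewrite (dotvBB m f) (dotvBB (mu k) f).
have yD u : dotv y u = dotv u f + dotv xi u by rewrite {1}yE dotvDl (dotvC f u).
by rewrite !yD (dotvC (mu k) m); lra.
Qed.

End oracle_inequality.

(** * Measurability of vector-valued maps and of finite minima *)

Section measurable_vectors.
Context {R : realType} {d : measure_display} {T : measurableType d} {n : nat}.
Implicit Types u v : T -> 'cV[R]_n.

Definition measurable_vec u := forall i, measurable_fun setT (fun t => u t i 0).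

Lemma measurable_vec_cst (c : 'cV[R]_n) : measurable_vec (fun=> c).
Proof. by move=> i; exact: measurable_cst. Qed.

Lemma measurable_vecD u v :
  measurable_vec u -> measurable_vec v -> measurable_vec (fun t => u t + v t).
Proof.
move=> mu mv i; under eq_fun do rewrite mxE; exact: measurable_funD.
Qed.

Lemma measurable_vecZ (c : T -> R) u : measurable_fun setT c ->
  measurable_vec u -> measurable_vec (fun t => c t *: u t).
Proof.
move=> mc mu i; under eq_fun do rewrite mxE; exact: measurable_funM.
Qed.

Lemma measurable_vec_sum m (u : 'I_m -> T -> 'cV[R]_n) :
  (forall j, measurable_vec (u j)) -> measurable_vec (fun t => \sum_j u j t).
Proof.
move=> mu i; under eq_fun do rewrite summxE.
by apply: measurable_sum => j; exact: mu.
Qed.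

Lemma measurable_vecM (B : 'M[R]_n) u :
  measurable_vec u -> measurable_vec (fun t => B *m u t).
Proof.
move=> mu i; under eq_fun do rewrite mxE.
by apply: measurable_sum => j; exact: measurable_funM.
Qed.

Lemma measurable_dotv u v : measurable_vec u -> measurable_vec v ->
  measurable_fun setT (fun t => dotv (u t) (v t)).
Proof. by move=> mu mv; apply: measurable_sum => i; exact: measurable_funM. Qed.

Lemma measurable_sqr_norm2 u : measurable_vec u ->
  measurable_fun setT (fun t => norm2 (u t) ^+ 2).
Proof.
by move=> mu; under eq_fun do rewrite sqr_norm2; exact: measurable_dotv.
Qed.

End measurable_vectors.

Lemma measurable_bigmine (R : realType) (d : measure_display)
    (T : measurableType d) (I : Type) (r : seq I) (h : I -> T -> \bar R) :
  (forall i, measurable_fun setT (h i)) ->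
  measurable_fun setT (fun t => \big[Order.min/+oo%E]_(i <- r) h i t).
Proof.
move=> mh; elim: r => [|i r IH].
  by under eq_fun do rewrite big_nil; exact: measurable_cst.
by under eq_fun do rewrite big_cons; exact: measurable_mine.
Qed.

(** * The bounds in deviation and in expectation *)

Theorem theorem2p1 (R : realType) (d : measure_display) (Omega : measurableType d)
  (P : probability Omega R) (n M : nat) (sigma : R)
  (f : 'cV[R]_n) (xi : 'I_n -> Omega -> R)
  (A : 'I_M -> 'M[R]_n) (b : 'I_M -> 'cV[R]_n)
  (thetahat : Omega -> 'I_M -> R) :
  (2 <= M)%N -> (0 < n)%N -> 0 < sigma ->
  (forall i, measurable_fun setT (xi i)) ->
  (forall i (B : set R), measurable B -> P (xi i @^-1` B) = normal_prob 0 sigma B) ->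
  mutually_independent P xi ->
  (forall j, opnorm_le1 (A j)) ->
  (forall j, measurable_fun setT (fun w => thetahat w j)) ->
  (forall w, is_argmin_Hpen A b sigma (thetahat w) (f + \col_i xi i w)) ->
  (forall x : R, 0 < x ->
     (P [set w | ((norm2 (mu_theta A b (thetahat w) (f + \col_i xi i w) - f) ^+ 2)%:E
          <= \big[Order.min/+oo%E]_(j < M)
               ((norm2 (mu_j A b j (f + \col_i xi i w) - f) ^+ 2)%:E)
             + (46 * sigma ^+ 2 * (2 * ln (M%:R) + x))%:E)%E]
       >= (1 - 2 * expR (- x))%:E)%E) /\
  (\int[P]_w ((norm2 (mu_theta A b (thetahat w) (f + \col_i xi i w) - f) ^+ 2)%:E)
     <= \int[P]_w (\big[Order.min/+oo%E]_(j < M)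
                    ((norm2 (mu_j A b j (f + \col_i xi i w) - f) ^+ 2)%:E))
        + (92 * sigma ^+ 2 * ln (expR 1 * M%:R))%:E)%E.
Proof.
move=> M2 _ s0 mxi lawxi indxi opA mtheta argmin.
have M0 : 0 < M%:R :> R by rewrite ltr0n (leq_trans _ M2).
have s2 : 0 < 46 * sigma ^+ 2 by rewrite mulr_gt0// exprn_gt0.
pose y w := f + \col_i xi i w.
pose loss w := norm2 (mu_theta A b (thetahat w) (y w) - f) ^+ 2.
pose lossj j w := norm2 (mu_j A b j (y w) - f) ^+ 2.
pose minloss w := (\big[Order.min/+oo%E]_(j < M) (lossj j w)%:E)%E.
pose D j k w := gap sigma (A j - A k) ((A j - A k) *m f + (b j - b k))
  (\col_i xi i w).
(* A sum of exponentials over all pairs dominates the exponential of the largest gap. *)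
pose S w := \sum_j \sum_k expR ((46 * sigma ^+ 2)^-1 * D j k w).
have mcol : measurable_vec (fun w => \col_i xi i w).
  by move=> i; under eq_fun do rewrite mxE; exact: mxi.
have my : measurable_vec y.
  by apply: measurable_vecD => //; exact: measurable_vec_cst.
have mmuj j : measurable_vec (fun w => mu_j A b j (y w)).
  apply: measurable_vecD; last exact: measurable_vec_cst.
  exact: measurable_vecM.
have mloss : measurable_fun setT loss.
  apply: measurable_sqr_norm2; apply: measurable_vecD.
    (* As a combination of the [mu_j] with measurable weights, the aggregate is measurable. *)
    rewrite (_ : (fun _ => _) = fun w => \sum_j thetahat w j *: mu_j A b j (y w)).
      by apply: measurable_vec_sum => j; exact: measurable_vecZ.
    by apply/funext => w; rewrite mu_thetaE.
  exact: measurable_vec_cst.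
have mminloss : measurable_fun setT minloss.
  apply: measurable_bigmine => j; apply/measurable_EFinP.
  apply: measurable_sqr_norm2.
  by apply: measurable_vecD; [exact: mmuj|exact: measurable_vec_cst].
have mexp j k : measurable_fun setT
    (fun w => expR ((46 * sigma ^+ 2)^-1 * D j k w)).
  apply: measurableT_comp => //; apply: measurable_funM => //.
  have mBv : measurable_vec (fun w => (A j - A k) *m (\col_i xi i w) +
      ((A j - A k) *m f + (b j - b k))).
    apply: measurable_vecD; last exact: measurable_vec_cst.
    exact: measurable_vecM.
  apply: measurable_funB; last first.
    by apply: measurable_funM => //; exact: measurable_dotv.
  apply: measurable_funB => //.
  by apply: measurable_funM => //; exact: measurable_dotv.
have mS : measurable_fun setT S.
  by apply: measurable_sum => j; apply: measurable_sum => k.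
have S0 w : 0 <= S w.
  by apply: sumr_ge0 => j _; apply: sumr_ge0 => k _; exact: expR_ge0.
have expS j k w : expR ((46 * sigma ^+ 2)^-1 * D j k w) <= S w.
  rewrite /S (bigD1 j)//= (bigD1 k)//= -addrA lerDl addr_ge0//.
    by apply: sumr_ge0 => i _; exact: expR_ge0.
  by apply: sumr_ge0 => i _; apply: sumr_ge0 => l _; exact: expR_ge0.
have ES : (\int[P]_w (S w)%:E <= (M%:R ^+ 2)%:E)%E.
  have sumle (F : 'I_M -> \bar R) c : (forall k, (F k <= c%:E)%E) ->
      (\sum_k F k <= (M%:R * c)%:E)%E.
    move=> Fc; apply: (@le_trans _ _ (\sum_(k < M) c%:E)%E); first exact: lee_sum.
    by rewrite sumEFin sumr_const card_ord mulr_natl.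
  under eq_integral do rewrite /S -sumEFin.
  rewrite ge0_integral_sum//; last 2 first.
  - by move=> j; apply/measurable_EFinP; exact: measurable_sum.
  - by move=> j w _; rewrite lee_fin; apply: sumr_ge0 => k _; exact: expR_ge0.
  apply: (sumle _ M%:R) => j; under eq_integral do rewrite -sumEFin.
  rewrite ge0_integral_sum//; last by move=> k; apply/measurable_EFinP.
  rewrite -[M%:R]mulr1; apply: (sumle _ 1) => k.
  by apply: gaussian_gap_mgf => //; exact: dotv_sub_le.
(* A common bound on all gaps bounds their average with weights [thetahat w], for every competitor
   [k] at once. *)
have key w c : (forall j k, D j k w <= c) ->
    ((loss w)%:E <= minloss w + c%:E)%E.
  move=> Dc; rewrite -leeBlDr//; apply: le_bigmin; first exact: leey.
  move=> k _; rewrite -EFinB lee_fin lerBlDr.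
  apply: le_trans (argmin_Hpen_oracle k erefl (argmin w)) _.
  rewrite lerD2l; have th := proj1 (argmin w).
  rewrite -[leRHS](sum_cst c th); apply: ler_sum => j _.
  by apply: ler_wpM2l; [exact: (proj2 th)|exact: Dc].
have M2E : expR (2 * ln M%:R) = M%:R ^+ 2 :> R.
  by rewrite expRM_natl lnK.
split=> [x x0|].
  have a0 : 0 < expR (2 * ln M%:R + x) :> R by exact: expR_gt0.
  set good := [set w | _].
  (* Outside [bad], each exponential is at most [S w < exp (2 ln M + x)], so each gap is at most
     [46 sigma^2 (2 ln M + x)]. *)
  pose bad := [set w | expR (2 * ln M%:R + x) <= S w].
  have mbad : measurable bad.
    rewrite -[bad]setTI; apply: measurable_fun_le => //; exact: measurable_cst.
  have mgood : measurable good.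
    rewrite -[good]setTI; apply: measurable_lee => //.
      exact/measurable_EFinP.
    by apply: emeasurable_funD => //; exact: measurable_cst.
  have badP : (P bad <= (expR (- x))%:E)%E.
    (* Markov's inequality for [S]: the mean bound [M^2] divided by the threshold [M^2 e^x] is
       [e^(-x)]. *)
    have := @le_integral_comp_abse _ _ _ P _ measurableT (EFin \o S)
      (expR (2 * ln M%:R + x)) id.
    rewrite setTI => /(_ (@measurable_id _ _ _))/(_ (fun _ => id)).
    move=> /(_ (fun _ _ _ _ => id)) mkv.
    have {mkv} : ((expR (2 * ln M%:R + x))%:E * P bad <= (M%:R ^+ 2)%:E)%E.
      rewrite (_ : bad = [set w | ((expR (2 * ln M%:R + x))%:E <=
        `|(EFin \o S) w|)%E]); last first.
        by apply/seteqP; split => w /=; rewrite lee_fin ger0_norm.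
      apply: le_trans (mkv _ a0) _; first exact/measurable_EFinP.
      by under eq_integral do rewrite /= ger0_norm//.
    rewrite -lee_pdivlMl// -EFinM => /le_trans; apply.
    rewrite lee_fin expRD M2E expRN invfM mulrAC mulVf ?mul1r//.
    by rewrite gt_eqF// exprn_gt0.
  apply: (@le_trans _ _ (P (~` bad))).
    rewrite probability_setC//.
    apply: (@le_trans _ _ (1 - (expR (- x))%:E)%E); last exact: leeB.
    by rewrite -EFinB lee_fin lerB// ler_peMl ?expR_ge0// ler1n.
  apply: le_measure; rewrite ?inE//; first exact: measurableC.
  move=> w /negP; rewrite -ltNge => Sw; apply: key => j k.
  rewrite -ler_pdivrMl// -ler_expR; apply: le_trans (expS j k w) _.
  exact: ltW.
(* For a scaled gap [l], [1 + u <= exp u] at [u = l - 2 ln M] gives [l <= 2 ln M + M^-2 exp l], and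
   [exp l <= S w]. The mean of [M^-2 S] is at most 1. *)
pose c w := 46 * sigma ^+ 2 * (2 * ln M%:R + (M%:R ^+ 2)^-1 * S w).
have lnM0 : 0 <= ln M%:R :> R by rewrite ln_ge0// ler1n (leq_trans _ M2).
have c0 w : 0 <= c w.
  by rewrite mulr_ge0 ?(ltW s2)// addr_ge0 ?mulr_ge0 ?invr_ge0 ?exprn_ge0
    ?(ltW M0).
have mc : measurable_fun setT c.
  apply: measurable_funM => //; apply: measurable_funD => //.
  exact: measurable_funM.
have minloss0 w : (0 <= minloss w)%E.
  by apply: le_bigmin => // j _; rewrite lee_fin sqr_ge0.
apply: (@le_trans _ _ (\int[P]_w (minloss w + (c w)%:E))%E).
  apply: ge0_le_integral => //.
  - by move=> w _; rewrite lee_fin sqr_ge0.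
  - exact/measurable_EFinP.
  - by apply: emeasurable_funD => //; exact/measurable_EFinP.
  - move=> w _; apply: key => j k.
    rewrite /c -ler_pdivrMl//; set l := _ * D j k w.
    have := expR_ge1Dx (l - 2 * ln M%:R).
    rewrite expRD expRN M2E => H.
    have : (M%:R ^+ 2)^-1 * expR l <= (M%:R ^+ 2)^-1 * S w.
      by rewrite ler_wpM2l ?invr_ge0 ?exprn_ge0 ?(ltW M0)//; exact: expS.
    move: H; rewrite mulrC; lra.
rewrite ge0_integralD//; last 2 first.
- by move=> w _; rewrite lee_fin.
- exact/measurable_EFinP.
apply: leeD2l.
(* The constant 92 leaves slack: [46 (2 ln M + 1) <= 92 (ln M + 1)]. *)
apply: (@le_trans _ _ ((46 * sigma ^+ 2 * (2 * ln M%:R + 1))%:E)%E); last first.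
  rewrite lee_fin lnM ?posrE ?expR_gt0// expRK.
  by have := sqr_ge0 sigma; lra.
pose a1 := 46 * sigma ^+ 2 * (2 * ln M%:R).
pose a2 := 46 * sigma ^+ 2 * (M%:R ^+ 2)^-1.
have a10 : 0 <= a1 by rewrite mulr_ge0 ?(ltW s2)// mulr_ge0.
have a20 : 0 <= a2 by rewrite mulr_ge0 ?(ltW s2)// invr_ge0 exprn_ge0 ?(ltW M0).
have mES : measurable_fun setT (fun w => (S w)%:E) by exact/measurable_EFinP.
have -> : (\int[P]_w (c w)%:E = \int[P]_w (a1%:E + a2%:E * (S w)%:E))%E.
  by apply: eq_integral => w _; rewrite -EFinM -EFinD /c /a1 /a2 mulrDr !mulrA.
rewrite ge0_integralD//; last 2 first.
- by move=> w _; rewrite mule_ge0// lee_fin.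
- exact: emeasurable_funM.
rewrite integral_cst//= probability_setT mule1 ge0_integralZl//; last first.
  by move=> w _; rewrite lee_fin.
rewrite mulrDr mulr1 EFinD; apply: leeD2l.
apply: le_trans (lee_wpmul2l _ ES) _; first by rewrite lee_fin.
rewrite -EFinM lee_fin /a2 -(mulrA (46 * sigma ^+ 2)) mulVf ?mulr1//.
by rewrite gt_eqF// exprn_gt0.
Qed.
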